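(* Let $0\le m<n$ be integers and let $A$ be an $n\times n$ real positive definite matrix with eigenvalues $\lambda_1(A),\dots,\lambda_n(A)$, indexed in nondecreasing order, and corresponding eigenvectors $v_1(A),\dots,v_n(A)$. The optimal solutions to $$\underset{X}{\text{minimize}}\ \operatorname{tr}(XA^{-1})-\log\det(XA^{-1})\quad\text{subject to}\quad X\in\mathcal{L}_{m,n},\ X\succ0$$ for which $v_k(X)=v_k(A)$ for all $k\in\{1,\dots,n\}$ are precisely those such that $$\lambda_i(X)=\lambda=\left(\frac{\lambda_l(A)^{-1}+\lambda_{l+1}(A)^{-1}+\dots+\lambda_{l+n-m-1}(A)^{-1}}{n-m}\right)^{-1}\quad\text{if } i\in\{l,\dots,l+n-m-1\},$$ $\lambda_i(X)=\lambda_i(A)$ otherwise, and $l$ is an integer (in $\{1,\dots,m+1\}$) that minimizes $$\sum_{i=l}^{l+n-m-1}\left(\frac{\lambda}{\lambda_i(A)}-\log\left(\frac{\lambda}{\lambda_i(A)}\right)\right),$$ where $\lambda$ depends on $l$ as displayed.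
   Context: $\mathcal{L}_{m,n}$ denotes the set of real $n\times n$ matrices $M$ that can be written as $M=\beta I+\sum_{i=1}^m a_iu_iu_i^T$ with $\beta,a_i\in\mathbb{R}$ and $u_i\in\mathbb{R}^n$. Positive definite matrices are understood to be symmetric, and $X\succ0$ means that $X$ is positive definite. The eigenvectors $v_1(A),\dots,v_n(A)$ form a fixed orthonormal basis, with $v_k(A)$ belonging to $\lambda_k(A)$. The condition $v_k(X)=v_k(A)$ for all $k$ means that each $v_k(A)$ is an eigenvector of $X$, and $\lambda_k(X)$ then denotes the eigenvalue of $X$ belonging to that eigenvector (so the $\lambda_k(X)$ are indexed by the eigenvectors of $A$).
   Formalization: If A has repeated eigenvalues, the formula for λ_i(X) is required only up to a renumbering of the eigenvectors among equal eigenvalues of A; with one fixed numbering ''precisely'' fails, e.g. A=diag(1,1,2,2), m=1, X=diag(6/5,6/5,2,6/5). *)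

(* Defs.v *)
From HB Require Import structures.
From mathcomp Require Import all_boot all_order all_algebra all_fingroup.
From mathcomp Require Import reals exp.

Set Implicit Arguments.
Unset Strict Implicit.
Unset Printing Implicit Defensive.

Import Order.TTheory GRing.Theory Num.Theory.
Local Open Scope ring_scope.

Definition posdefmx (R : realType) (n : nat) (M : 'M[R]_n) : Prop :=
  M^T = M /\ forall x : 'cV[R]_n, x != 0 -> 0 < (x^T *m M *m x) 0 0.

Definition scalar_plus_rank_ones (R : realType) (m n : nat) (M : 'M[R]_n) : Prop :=
  exists (beta : R) (a : 'I_m -> R) (u : 'I_m -> 'cV[R]_n),
    M = beta%:M + \sum_(i < m) a i *: (u i *m (u i)^T).

Definition orthonormal_cols (R : realType) (n : nat) (v : 'I_n -> 'cV[R]_n) : Prop :=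
  forall j k : 'I_n, ((v j)^T *m v k) 0 0 = (j == k)%:R.

(* When v is orthonormal, mu lists all eigenvalues of M with multiplicity. *)
Definition eigenpairs (R : realType) (n : nat) (M : 'M[R]_n)
    (mu : 'I_n -> R) (v : 'I_n -> 'cV[R]_n) : Prop :=
  forall k : 'I_n, M *m v k = mu k *: v k.

Definition objective (R : realType) (n : nat) (A X : 'M[R]_n) : R :=
  \tr (X *m invmx A) - ln (\det (X *m invmx A)).

Definition feasible (R : realType) (m n : nat) (X : 'M[R]_n) : Prop :=
  scalar_plus_rank_ones m X /\ posdefmx X.

Definition optimal (R : realType) (m n : nat) (A X : 'M[R]_n) : Prop :=
  feasible m X /\
  forall Y : 'M[R]_n, feasible m Y -> objective A X <= objective A Y.

(* Indices start at 0: the l-th window is {l, ..., l + n - m - 1} with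
   0 <= l <= m, i.e. l : 'I_m.+1. *)
Definition in_window (m n : nat) (l : 'I_m.+1) (i : 'I_n) : bool :=
  (l <= i < l + (n - m))%N.

Definition window_hmean (R : realType) (m n : nat) (lam : 'I_n -> R)
    (l : 'I_m.+1) : R :=
  ((\sum_(i < n | in_window l i) (lam i)^-1) / (n - m)%:R)^-1.

Definition window_cost (R : realType) (m n : nat) (lam : 'I_n -> R)
    (l : 'I_m.+1) : R :=
  \sum_(i < n | in_window l i)
    (window_hmean lam l / lam i - ln (window_hmean lam l / lam i)).

Definition window_minimizer (R : realType) (m n : nat) (lam : 'I_n -> R)
    (l : 'I_m.+1) : Prop :=
  forall l' : 'I_m.+1, window_cost lam l <= window_cost lam l'.

Definition window_eigenvalue (R : realType) (m n : nat) (lam : 'I_n -> R)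
    (l : 'I_m.+1) (i : 'I_n) : R :=
  if in_window l i then window_hmean lam l else lam i.

(* A renumbering of the eigenvectors that keeps lam sorted: it only permutes
   indices carrying equal eigenvalues, hence is the identity when the
   eigenvalues are distinct. *)
Definition tie_perm (R : realType) (n : nat) (lam : 'I_n -> R)
    (s : {perm 'I_n}) : Prop :=
  forall k : 'I_n, lam (s k) = lam k.

(* Main.v *)
(* Write phi t = t - ln t, so that phi >= 1 with equality only at t = 1. If X and
   A have orthonormal eigenbases (mu_j, w_j) and (lam_k, v_k), then
   objective A X = sum_{j,k} (w_j . v_k)^2 phi (mu_j / lam_k), with doubly
   stochastic weights. Since X - beta I has rank at most m, n - m of the mu_j
   equal beta; bounding phi by 1 in the other terms gives
   objective A X >= m + sum_k d_k phi (beta / lam_k) with weights 0 <= d_k <= 1 of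
   total n - m. The right-hand side is least when d is the indicator of the n - m
   smallest values of phi (beta / lam_k); as phi is strictly decreasing and then
   strictly increasing, these indices form a window, up to ties in lam. For a
   fixed window the best beta is the harmonic mean of its lam_k. *)
Require Import Defs.
From HB Require Import structures.
From mathcomp Require Import all_boot all_order all_algebra all_fingroup.
From mathcomp Require Import reals exp complex ring lra zify.

Set Implicit Arguments.
Unset Strict Implicit.
Unset Printing Implicit Defensive.

Import Order.TTheory GRing.Theory Num.Theory.
Local Open Scope ring_scope.

(** * The spectral theorem for real symmetric matrices *)

(** [a] and [b] are the real and imaginary parts of a complex left eigenvector of [T] with
    eigenvalue [p + i q]. One exists because the characteristic polynomial has positive degree. *)
Lemma real_eigenplane (R : rcfType) (n : nat) (T : 'M[R]_n) : (0 < n)%N ->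
  exists (p q : R) (a b : 'rV[R]_n), [/\ (a != 0) || (b != 0),
    a *m T = p *: a - q *: b & b *m T = q *: a + p *: b].
Proof.
move=> n0.
pose f := real_complex R : {rmorphism R -> R[i]}.
have /closed_rootP [z] : size (char_poly (map_mx f T)) != 1%N.
  by rewrite size_char_poly; case: (n) n0.
rewrite -eigenvalue_root_char => /eigenvalueP [v vT v0].
have ReD : {morph (@complex.Re R) : x y / x + y} by case=> ? ? [].
have ImD : {morph (@complex.Im R) : x y / x + y} by case=> ? ? [].
exists (complex.Re z), (complex.Im z), (map_mx (@complex.Re R) v), (map_mx (@complex.Im R) v).
split.
- apply: contraT; rewrite negb_or !negbK => /andP[/eqP a0 /eqP b0].
  case/eqP: v0; apply/rowP => j; move/rowP/(_ j): a0; move/rowP/(_ j): b0.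
  by rewrite !mxE; case: (v 0 j) => /= ? ? -> ->.
- apply/rowP => j; move/rowP/(_ j): vT; rewrite !mxE => /(congr1 (@complex.Re R)).
  rewrite (big_morph _ ReD (erefl _)) => vTj.
  transitivity (complex.Re (z * v 0 j)); last by case: (z) (v 0 j) => ? ? [].
  by rewrite -vTj; apply: eq_bigr => i _; rewrite !mxE;
  case: (v 0 i) => x y /=; rewrite mulr0 subr0.
- apply/rowP => j; move/rowP/(_ j): vT; rewrite !mxE => /(congr1 (@complex.Im R)).
  rewrite (big_morph _ ImD (erefl _)) => vTj.
  transitivity (complex.Im (z * v 0 j)); last by case: (z) (v 0 j) => ? ? [? ?] /=; rewrite addrC.
  by rewrite -vTj; apply: eq_bigr => i _; rewrite !mxE;
  case: (v 0 i) => x y /=; rewrite mulr0 add0r.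
Qed.

Lemma mulmx_tr_ge0 (R : rcfType) (n : nat) (x : 'rV[R]_n) : 0 <= (x *m x^T) 0 0.
Proof. by rewrite mxE sumr_ge0 // => i _; rewrite mxE -expr2 sqr_ge0. Qed.

Lemma mulmx_tr_eq0 (R : rcfType) (n : nat) (x : 'rV[R]_n) :
  ((x *m x^T) 0 0 == 0) = (x == 0).
Proof.
apply/idP/eqP => [|->]; last by rewrite mul0mx mxE.
rewrite mxE psumr_eq0 => [/allP x0|i _]; last by rewrite mxE -expr2 sqr_ge0.
apply/rowP => i; have := x0 i (mem_index_enum _).
by rewrite mxE -expr2 sqrf_eq0 => /eqP ->; rewrite mxE.
Qed.

(* The complex eigenvalue [p + i q] of the compression of [X] to the orthogonal
   complement of the rows of [W] is real by symmetry, so [a] or [b] works. *)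
Lemma extend_eigenrows (R : rcfType) (n k : nat) (X : 'M[R]_n) (W : 'M[R]_(k, n))
    (d : 'rV[R]_k) : X^T = X -> (k < n)%N ->
    W *m W^T = 1%:M -> W *m X = diag_mx d *m W ->
  exists (p : R) (x : 'rV[R]_n),
    [/\ x *m x^T = 1%:M, x *m W^T = 0 & x *m X = p *: x].
Proof.
move=> Xsym kn WW WX.
pose K := row_base (kermx W^T).
have KW : K *m W^T = 0 by apply/sub_kermxP; rewrite eq_row_base.
have Kfree : row_free K by exact: row_base_free.
have rk : (0 < \rank (kermx W^T))%N.
  rewrite mxrank_ker subn_gt0 (leq_ltn_trans _ kn) //.
  exact: rank_leq_col.
(* By symmetry [X] preserves the orthogonal complement of the rows of [W]. The rows of [K] are a
   basis of it, and [T] is the matrix of [X] there. *)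
have /submxP [T KT] : (K *m X <= K)%MS.
  rewrite eq_row_base.
  apply/sub_kermxP; rewrite -mulmxA -[in X *m _]Xsym -trmx_mul WX trmx_mul.
  by rewrite mulmxA KW mul0mx.
have [p [q [a [b [ab0 aT bT]]]]] := real_eigenplane T rk.
have aX : a *m K *m X = p *: (a *m K) - q *: (b *m K).
  by rewrite -mulmxA KT mulmxA aT mulmxBl -!scalemxAl.
have bX : b *m K *m X = q *: (a *m K) + p *: (b *m K).
  by rewrite -mulmxA KT mulmxA bT mulmxDl -!scalemxAl.
have K0 (y : 'rV_ _) : (y *m K == 0) = (y == 0).
  by rewrite -[in LHS](mul0mx 1 K) (inj_eq (row_free_inj Kfree)).
have normal (x : 'rV_n) : x != 0 -> x *m W^T = 0 -> x *m X = p *: x ->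
    exists x0 : 'rV_n, [/\ x0 *m x0^T = 1%:M, x0 *m W^T = 0 & x0 *m X = p *: x0].
  move=> x0 xW xX; have x2 : 0 < (x *m x^T) 0 0.
    by rewrite lt_neqAle mulmx_tr_ge0 andbT eq_sym mulmx_tr_eq0.
  exists ((Num.sqrt ((x *m x^T) 0 0))^-1 *: x); split.
  - rewrite linearZ /= -scalemxAl -scalemxAr scalerA -invfM -expr2.
    rewrite sqr_sqrtr ?ltW // [X in _ *: X]mx11_scalar scale_scalar_mx.
    by rewrite mulVf ?gt_eqF.
  - by rewrite -scalemxAl xW scaler0.
  - by rewrite -scalemxAl xX !scalerA mulrC.
have q0 : q = 0.
  (* The basis [K] need not be orthonormal, so [T] need not be symmetric. The symmetry of [X] is
     used on [a *m K] and [b *m K] instead, and yields [q * (|a K|^2 + |b K|^2) = 0]. *)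
  have e : (a *m K *m X *m (b *m K)^T) 0 0 = (b *m K *m X *m (a *m K)^T) 0 0.
    rewrite -[in RHS]Xsym -mulmxA -{2}[b *m K]trmxK -trmx_mul.
    rewrite -[(a *m K *m _)]trmxK -trmx_mul mxE.
    by rewrite !mulmxA trmx_mul trmxK.
  move: e; rewrite aX bX mulmxBl mulmxDl -!scalemxAl.
  have -> : a *m K *m (b *m K)^T = b *m K *m (a *m K)^T.
    rewrite -[RHS]trmxK [in RHS]trmx_mul trmxK; apply/matrixP => i j.
    by rewrite !ord1 [RHS]mxE.
  have := mulmx_tr_ge0 (a *m K); have := mulmx_tr_ge0 (b *m K).
  have := mulmx_tr_eq0 (a *m K); have := mulmx_tr_eq0 (b *m K).
  rewrite !K0 !mxE; set s := \sum_j _; set t := \sum_j _; set r := \sum_j _.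
  move=> s0 t0 sp tp e; have : q * (s + t) == 0 by apply/eqP; lra.
  rewrite mulf_eq0 paddr_eq0 // s0 t0 => /orP[/eqP //|/andP[bb aa]].
  by rewrite aa bb in ab0.
rewrite q0 !scale0r ?subr0 ?add0r in aX bX.
exists p; case/orP: ab0 => x0.
- by apply: (normal (a *m K)) => //; rewrite ?K0 // -mulmxA KW mulmx0.
- by apply: (normal (b *m K)) => //; rewrite ?K0 // -mulmxA KW mulmx0.
Qed.

(** Induction on [k], adjoining one unit eigenvector at a time; [k = n] gives the spectral
    theorem. *)
Lemma symmetric_eigenrows (R : rcfType) (n k : nat) (X : 'M[R]_n) :
    X^T = X -> (k <= n)%N ->
  exists (W : 'M[R]_(k, n)) (d : 'rV[R]_k),
    W *m W^T = 1%:M /\ W *m X = diag_mx d *m W.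
Proof.
move=> Xsym; elim: k => [|k IHk] kn.
  by exists 0, 0; split; apply/matrixP => -[].
have [W [d [WW WX]]] := IHk (ltnW kn).
have [p [x [xx xW xX]]] := extend_eigenrows Xsym kn WW WX.
suff: exists (W' : 'M[R]_(1 + k, n)) (d' : 'rV[R]_(1 + k)),
    W' *m W'^T = 1%:M /\ W' *m X = diag_mx d' *m W' by [].
exists (col_mx x W), (row_mx p%:M d); split.
  rewrite tr_col_mx mul_col_row xx xW WW.
  have -> : W *m x^T = 0 by rewrite -[W]trmxK -trmx_mul xW trmx0.
  by rewrite -scalar_mx_block.
rewrite mul_col_mx xX WX diag_mx_row mul_block_col !mul0mx addr0 add0r.
congr col_mx; rewrite -mul_scalar_mx; congr (_ *m _).
by apply/matrixP => i j; rewrite !ord1 !mxE.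
Qed.

Definition cols_mx (R : realType) (n : nat) (v : 'I_n -> 'cV[R]_n) : 'M[R]_n :=
  \matrix_(i, k) v k i 0.

Lemma orthonormal_colsP (R : realType) (n : nat) (v : 'I_n -> 'cV[R]_n) :
  orthonormal_cols v <-> (cols_mx v)^T *m cols_mx v = 1%:M.
Proof.
split=> [hv|hv j k].
  apply/matrixP => j k; rewrite !mxE -hv mxE; apply: eq_bigr => i _.
  by rewrite !mxE.
move/matrixP/(_ j k): hv; rewrite !mxE => <-; apply: eq_bigr => i _.
by rewrite !mxE.
Qed.

Theorem symmetric_spectral (R : realType) (n : nat) (X : 'M[R]_n) : X^T = X ->
  exists (mu : 'I_n -> R) (w : 'I_n -> 'cV[R]_n),
    orthonormal_cols w /\ eigenpairs X mu w.
Proof.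
move=> Xsym; have [W [d [WW WX]]] := symmetric_eigenrows Xsym (leqnn n).
exists (fun i => d 0 i), (fun i => (row i W)^T); split.
  apply/orthonormal_colsP; rewrite (_ : cols_mx _ = W^T) ?trmxK //.
  by apply/matrixP => i j; rewrite !mxE.
move=> k; rewrite -Xsym -trmx_mul -linearZ /=; congr trmx.
by rewrite -row_mul WX row_mul row_diag_mx -scalemxAl -rowE.
Qed.

(** * The function phi and sets of smallest sum *)

Definition phi (R : realType) (x : R) : R := x - ln x.

(* Strict convexity of [phi], whose derivative at [t] is [1 - t^-1]. *)
Lemma phi_tangent (R : realType) (s t : R) : 0 < s -> 0 < t -> s != t ->
  phi t + (s - t) * (1 - t^-1) < phi s.
Proof.
move=> s0 t0 st; have st0 : 0 < s / t by rewrite divr_gt0.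
have : ln (s / t) != 0.
  rewrite ln_eq0 //; apply: contra st => /eqP st1.
  by rewrite -[s](divfK (lt0r_neq0 t0)) st1 mul1r.
move=> /expR_gt1Dx; rewrite lnK // ln_div //.
have -> : (s - t) * (1 - t^-1) = s - t - s / t + 1 by field; rewrite gt_eqF.
by rewrite /phi; lra.
Qed.

(** The tangent of [phi] at 1 is horizontal, and by strict convexity it meets the graph only
    there. *)
Lemma phi_ge1 (R : realType) (t : R) : 0 < t -> 1 <= phi t ?= iff (t == 1).
Proof.
move=> t0; apply/leifP; case: eqVneq => [->|t1]; first by rewrite /phi ln1 subr0.
by have := phi_tangent t0 ltr01 t1; rewrite invr1 subrr mulr0 addr0 {1}/phi ln1 subr0.
Qed.

(** Strict quasiconvexity: the tangent at [t] has slope at most 0 if [t <= 1], so [phi] is larger to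
    the left of [t]; otherwise it is larger to the right. *)
Lemma phi_between (R : realType) (s t u : R) : 0 < s -> s < t -> t < u ->
  phi t < phi s \/ phi t < phi u.
Proof.
move=> s0 st tu; have t0 := lt_trans s0 st; have u0 := lt_trans t0 tu.
have [t1|t1] := leP t 1.
  left; have := phi_tangent s0 t0; rewrite lt_eqF // => /(_ isT); apply: le_lt_trans.
  by rewrite lerDl mulr_le0 ?subr_le0 ?(ltW st) // invf_ge1.
right; have := phi_tangent u0 t0; rewrite gt_eqF // => /(_ isT); apply: le_lt_trans.
by rewrite lerDl mulr_ge0 ?subr_ge0 ?(ltW tu) // invf_le1 // ltW.
Qed.

Definition min_sum_set (R : realDomainType) (I : finType) (g : I -> R) (S : {set I}) : Prop :=
  forall S' : {set I}, #|S'| = #|S| -> \sum_(i in S) g i <= \sum_(i in S') g i.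

Lemma exists_min_sum_set (R : realDomainType) (I : finType) (g : I -> R) (p : nat) :
  (p <= #|I|)%N -> exists S : {set I}, #|S| = p /\ min_sum_set g S.
Proof.
move=> pI; have [S0 S0p] : exists S0 : {set I}, #|S0| == p.
  exists [set i in take p (enum I)]; rewrite cardsE.
  by rewrite (card_uniqP _) ?take_uniq ?enum_uniq // size_take -cardE; case: ltngtP pI => // ->.
pose F (S : {set I}) := \sum_(i in S) g i.
case: (@arg_minP _ R _ S0 (fun S => #|S| == p) F S0p) => S /eqP Sp Smin.
by exists S; split=> // S' cS; apply: Smin; rewrite cS Sp.
Qed.

(** Exchange argument: replacing [a] by [k] in [S] keeps the cardinality. *)
Lemma min_sum_set_threshold (R : realDomainType) (I : finType) (g : I -> R)
    (S : {set I}) (a k : I) :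
  min_sum_set g S -> a \in S -> k \notin S -> g a <= g k.
Proof.
move=> Smin aS kS; have kSa : k \notin S :\ a by rewrite in_setD1 negb_and kS orbT.
have := Smin (k |: S :\ a); rewrite cardsU1 kSa (cardsD1 a S) aS => /(_ erefl).
rewrite (big_setD1 a) //= [leRHS](big_setD1 k) ?setU11 //= setU1K //.
by rewrite lerD2r.
Qed.

Lemma sum_indicator (R : realDomainType) (I : finType) (S : {set I}) :
  \sum_i (i \in S)%:R = #|S|%:R :> R.
Proof. by rewrite -natr_sum -sum1_card [in RHS]big_mkcond. Qed.

(** Let [c] be the largest value of [g] on [S]. Then [d i] minus the indicator of [S] and [g i - c]
    never have opposite signs. In the sum of their products [c] drops out, since both weights have
    the same total. *)
Lemma min_sum_set_weights (R : realDomainType) (I : finType) (g d : I -> R) (S : {set I}) :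
  min_sum_set g S -> (0 < #|S|)%N -> (forall i, 0 <= d i <= 1) -> \sum_i d i = #|S|%:R ->
  \sum_(i in S) g i <= \sum_i d i * g i.
Proof.
move=> Smin; rewrite card_gt0 => /set0Pn[a0 a0S] d01 sumd.
case: (@arg_maxP _ R _ a0 (mem S) g a0S) => a aS amax.
have : 0 <= \sum_i (d i - (i \in S)%:R) * (g i - g a).
  apply: sumr_ge0 => i _; have /andP[d0 d1] := d01 i.
  have [iS|iS] := boolP (i \in S); first by rewrite mulr_le0 ?subr_le0 //; apply: amax.
  by rewrite subr0 mulr_ge0 // subr_ge0 (min_sum_set_threshold Smin).
under eq_bigr do rewrite mulrBr mulrBl.
rewrite !sumrB -mulr_suml sumrB sumd sum_indicator subrr mul0r subr0.
rewrite subr_ge0; apply: le_trans; rewrite big_mkcond /=.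
by apply: ler_sum => i _; case: ifP => _; rewrite ?mul1r ?mul0r.
Qed.

(* The permutation sorts by [lam], ties being broken so that the elements of [S]
   come after the other elements if [lam] is below its maximum on [S], and before
   them otherwise. *)
Lemma no_gap_window (R : realType) (n : nat) (lam : 'I_n -> R) (S : {set 'I_n}) :
    (forall i j : 'I_n, (i <= j)%N -> lam i <= lam j) -> (0 < #|S|)%N ->
    (forall a b k, a \in S -> b \in S -> k \notin S -> ~~ (lam a < lam k < lam b)) ->
  exists (s : {perm 'I_n}) (l : nat), [/\ tie_perm lam s, (l + #|S| <= n)%N
    & forall i, (s i \in S) = (l <= i < l + #|S|)%N].
Proof.
move=> lam_mono; rewrite card_gt0 => /set0Pn[a0 a0S] nogap.
case: (@arg_maxP _ R _ a0 (mem S) lam a0S) => b bS bmax.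
(* Having no gap makes [key] nondecreasing along the sorted indices: first 0s, then 1s, then 2s. The
   block of 1s is [S], and it starts at the number of keys below 1. *)
pose key i := if i \in S then 1%N else if lam i < lam b then 0%N else 2%N.
have key_mono i j : lam i < lam j -> (key i <= key j)%N.
  rewrite /key => ij; have [iS|iS] := boolP (i \in S); have [jS|jS] := boolP (j \in S) => //.
  - by case: ifPn => // jb; have := nogap _ _ _ iS bS jS; rewrite ij jb.
  - by case: ifPn => // /negP[]; apply: lt_le_trans ij (bmax _ jS).
  - case: ifPn => // ib; case: ifPn => // jb.
    by rewrite (lt_trans ij jb) in ib.
pose r i j := (lam i < lam j) || (lam i == lam j) && (key i <= key j)%N.
have r_total : total r.
  move=> i j; rewrite /r; case: (ltgtP (lam i) (lam j)) => //= _.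
  exact: leq_total.
have r_lam i j : r i j -> lam i <= lam j.
  by rewrite /r le_eqVlt => /orP[->|/andP[-> _]]; rewrite ?orbT.
have r_key i j : r i j -> (key i <= key j)%N.
  by move=> /orP[/key_mono //|/andP[_]].
pose t := sort r (enum 'I_n).
have t_perm : perm_eq t (enum 'I_n) by rewrite perm_sort.
have t_size : size t = n by rewrite size_sort size_enum_ord.
have t_sorted : sorted r t by apply: sort_sorted.
have t_uniq : uniq t by rewrite sort_uniq enum_uniq.
have s_inj : injective (fun i : 'I_n => nth i t i).
  move=> i j; rewrite (set_nth_default i) ?t_size ?ltn_ord // => /eqP.
  by rewrite nth_uniq ?t_size // => /eqP /val_inj.
pose s := perm s_inj.
(* Both lists are sorted and have the same entries, so reordering leaves the value of [lam] at each
   position unchanged. This is [tie_perm]. *)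
have lam_eq : map lam t = map lam (enum 'I_n).
  apply: (sorted_eq le_trans le_anti); last exact: perm_map.
  - exact: homo_sorted t_sorted.
  - rewrite sorted_map; apply: (@sub_sorted _ (relpre val ltn)).
      by move=> i j /= /ltnW; apply: lam_mono.
    by rewrite -sorted_map val_enum_ord iota_ltn_sorted.
have key_sorted : sorted <=%O (map key t) by apply: homo_sorted t_sorted.
have s_key i : key (s i) = nth 0%N (map key t) i.
  by rewrite permE (nth_map i) ?t_size.
exists s, (count (< 1%N)%O (map key t)).
have cS : (count (< 1%N)%O (map key t) + #|S|)%N = count (<= 1%N)%O (map key t).
  rewrite -[RHS](@eq_count _ (predU (< 1%N)%O (pred1 1%N))); last by case=> [|[|]].
  have disj : count (predI (< 1%N)%O (pred1 1%N)) (map key t) = 0%N.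
    by rewrite (@eq_count _ _ pred0) ?count_pred0 // => -[|[|]].
  have := count_predUI (< 1%N)%O (pred1 1%N) (map key t); rewrite disj addn0 => ->.
  congr addn; rewrite count_map (seq.permP t_perm).
  rewrite cardE {1}/enum_mem size_filter -enumT; apply: eq_count => i /=.
  by rewrite /key; case: ifP => // _; case: ifP.
rewrite cS; split.
- move=> i; rewrite permE; have := congr1 (fun u => nth (lam i) u i) lam_eq.
  by rewrite (nth_map i) ?t_size // (nth_map i) ?size_enum_ord // nth_ord_enum.
- by rewrite -[X in (_ <= X)%N]t_size -(size_map key t) count_size.
move=> i; have -> : (s i \in S) = (key (s i) == 1%N).
  by rewrite /key; case: ifP => // _; case: ifP.
rewrite s_key; apply/eqP/idP => [k1|]; last exact: nth_count_eq.
apply/andP; split; rewrite leqNgt; apply/negP => h.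
- by have := nth_count_lt 0%N key_sorted h; rewrite k1.
- have := @nth_count_gt _ _ 1%N 0%N _ i key_sorted.
  by rewrite -ltnS h size_map t_size ltn_ord k1 => /(_ erefl).
Qed.

(** * Orthonormal eigenbases *)

Section Eigenbasis.
Variables (R : realType) (n : nat).
Implicit Types (v w : 'I_n -> 'cV[R]_n) (mu lam : 'I_n -> R) (M A X : 'M[R]_n).

Lemma cols_mx_mul_tr v : orthonormal_cols v -> cols_mx v *m (cols_mx v)^T = 1%:M.
Proof. by move/orthonormal_colsP/mulmx1C. Qed.

Lemma eigenpairsP M mu v :
  eigenpairs M mu v <-> M *m cols_mx v = cols_mx v *m diag_mx (\row_k mu k).
Proof.
have colE N k : col k (N *m cols_mx v) = N *m v k.
  by rewrite colE -mulmxA -colE; congr mulmx; apply/colP => i; rewrite !mxE.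
have colD k : col k (cols_mx v *m diag_mx (\row_k mu k)) = mu k *: v k.
  by apply/colP => i; rewrite mul_mx_diag !mxE mulrC.
split=> [Mv|Mv k]; last by rewrite -colE Mv colD.
by apply/matrixP => i k; move/colP/(_ i): (Mv k); rewrite -colE -colD !mxE.
Qed.

Lemma eigenpairs_decomp M mu v : orthonormal_cols v ->
  eigenpairs M mu v <-> M = cols_mx v *m diag_mx (\row_k mu k) *m (cols_mx v)^T.
Proof.
move=> hv; have VV := cols_mx_mul_tr hv; move/orthonormal_colsP: hv => VtV.
split=> [/eigenpairsP <-|->]; first by rewrite -mulmxA VV mulmx1.
by apply/eigenpairsP; rewrite -mulmxA VtV mulmx1.
Qed.

Lemma eigenpairs_unique M N mu v : orthonormal_cols v ->
  eigenpairs M mu v -> eigenpairs N mu v -> M = N.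
Proof. by move=> hv /(eigenpairs_decomp _ _ hv) -> /(eigenpairs_decomp _ _ hv) ->. Qed.

Lemma det_eigenpairs M mu v : orthonormal_cols v -> eigenpairs M mu v ->
  \det M = \prod_k mu k.
Proof.
move=> hv /(eigenpairs_decomp _ _ hv) ->; rewrite !det_mulmx mulrAC -det_mulmx.
rewrite cols_mx_mul_tr // det1 mul1r det_diag.
by apply: eq_bigr => k _; rewrite mxE.
Qed.

Lemma invmx_eigenpairs M mu v : orthonormal_cols v -> (forall k, 0 < mu k) ->
  eigenpairs M mu v -> eigenpairs (invmx M) (fun k => (mu k)^-1) v.
Proof.
move=> hv mu0 Mv k; have Mu : M \in unitmx.
  rewrite unitmxE (det_eigenpairs hv Mv) unitfE prodf_seq_neq0.
  by apply/allP => i _; rewrite /= gt_eqF.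
apply: (can_inj (mulKmx Mu)); rewrite mulmxA mulmxV // mul1mx -scalemxAr Mv.
by rewrite scalerA mulVf ?scale1r // gt_eqF.
Qed.

(** Parseval's identity: the sum is the squared length of [V^T *m x], and [V *m V^T = 1]. *)
Lemma sum_sqr_dot v (x : 'cV[R]_n) : orthonormal_cols v ->
  \sum_k ((v k)^T *m x) 0 0 ^+ 2 = (x^T *m x) 0 0.
Proof.
move=> hv; set V := cols_mx v.
have -> : x^T *m x = (V^T *m x)^T *m (V^T *m x).
  by rewrite trmx_mul trmxK mulmxA -(mulmxA x^T) cols_mx_mul_tr // mulmx1.
rewrite [RHS]mxE; apply: eq_bigr => k _; rewrite [X in X * _]mxE -expr2.
by congr (_ ^+ 2); rewrite !mxE; apply: eq_bigr => i _; rewrite !mxE.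
Qed.

Lemma dotC (x y : 'cV[R]_n) : (x^T *m y) 0 0 = (y^T *m x) 0 0.
Proof. by rewrite !mxE; apply: eq_bigr => i _; rewrite !mxE mulrC. Qed.

Lemma quadratic_form_eigenpairs M mu v (x : 'cV[R]_n) :
    orthonormal_cols v -> eigenpairs M mu v ->
  (x^T *m M *m x) 0 0 = \sum_k mu k * ((v k)^T *m x) 0 0 ^+ 2.
Proof.
move=> hv /(eigenpairs_decomp _ _ hv) ->; set V := cols_mx v.
have -> : x^T *m (V *m diag_mx (\row_k mu k) *m V^T) *m x =
    (V^T *m x)^T *m diag_mx (\row_k mu k) *m (V^T *m x).
  by rewrite trmx_mul trmxK !mulmxA.
rewrite mxE; apply: eq_bigr => k _; rewrite mul_mx_diag mxE [X in X * _ * _]mxE.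
rewrite [X in _ * X * _]mxE mulrAC mulrC -expr2.
by congr (_ * _ ^+ 2); rewrite !mxE; apply: eq_bigr => i _; rewrite !mxE.
Qed.

Lemma posdefmx_eigenpairs M mu v : orthonormal_cols v -> eigenpairs M mu v ->
  posdefmx M <-> forall k, 0 < mu k.
Proof.
move=> hv Mv; split=> [[_ Mpos] k|mu0].
  have vk : (v k)^T *m v k = 1%:M.
    by rewrite [LHS]mx11_scalar hv eqxx.
  have := Mpos (v k); rewrite -mulmxA Mv -scalemxAr vk !mxE eqxx mulr1; apply.
  apply/eqP => v0; move: (hv k k); rewrite v0 mulmx0 mxE eqxx => /eqP.
  by rewrite eq_sym oner_eq0.
split.
  rewrite {1 2}((eigenpairs_decomp _ _ hv).1 Mv) !trmx_mul trmxK tr_diag_mx.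
  by rewrite mulmxA.
move=> x x0; rewrite (quadratic_form_eigenpairs _ hv Mv).
have ge0 k : 0 <= mu k * ((v k)^T *m x) 0 0 ^+ 2 by rewrite mulr_ge0 ?sqr_ge0 ?ltW.
(* If the form vanishes at [x], then [x] is orthogonal to every [v k], hence zero by Parseval. *)
rewrite lt_neqAle sumr_ge0 // andbT eq_sym psumr_eq0 //.
apply: contra x0 => /allP vx0; rewrite -trmx_eq0 -mulmx_tr_eq0 trmxK -(sum_sqr_dot _ hv).
apply/eqP; apply: big1 => k _; have := vx0 k (mem_index_enum _).
by rewrite /= mulf_eq0 gt_eqF //= => /eqP.
Qed.

Lemma objective_eigenpairs A X lam mu v w :
    orthonormal_cols v -> eigenpairs A lam v -> (forall k, 0 < lam k) ->
    orthonormal_cols w -> eigenpairs X mu w -> (forall k, 0 < mu k) ->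
  objective A X =
  \sum_j \sum_k ((w j)^T *m v k) 0 0 ^+ 2 * phi (mu j / lam k).
Proof.
move=> hv Av lam0 hw Xw mu0; have Aiv := invmx_eigenpairs hv lam0 Av.
rewrite /objective det_mulmx (det_eigenpairs hw Xw) (det_eigenpairs hv Aiv).
rewrite lnM ?posrE ?prodr_gt0 // => [|i _]; last by rewrite invr_gt0.
have ln_prod (f : 'I_n -> R) : (forall i, 0 < f i) -> ln (\prod_i f i) = \sum_i ln (f i).
  move=> f0; suff [] : 0 < \prod_i f i /\ ln (\prod_i f i) = \sum_i ln (f i) by [].
  apply: (big_ind2 (fun x y => 0 < x /\ ln x = y)); first by rewrite ltr01 ln1.
  - by move=> ? ? ? ? [? <-] [? <-]; rewrite mulr_gt0 // lnM.
  - by [].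
rewrite !ln_prod // => [|i]; last by rewrite invr_gt0.
(* By cyclicity the trace is the sum over [k] of [(lam k)^-1] times the quadratic form of [X] at
   [v k], which is then expanded in the basis [w]. *)
have -> : \tr (X *m invmx A) =
    \sum_j \sum_k ((w j)^T *m v k) 0 0 ^+ 2 * (mu j / lam k).
  rewrite ((eigenpairs_decomp _ _ hv).1 Aiv) mulmxA mxtrace_mulC !mulmxA exchange_big.
  apply: eq_bigr => k _; rewrite mul_mx_diag !mxE mulrC.
  transitivity ((lam k)^-1 * ((v k)^T *m X *m v k) 0 0).
    congr (_ * _); rewrite !mxE; apply: eq_bigr => i _; rewrite !mxE; congr (_ * _).
    by apply: eq_bigr => l _; rewrite !mxE.
  rewrite (quadratic_form_eigenpairs _ hw Xw) mulr_sumr; apply: eq_bigr => j _.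
  by rewrite mulrC [_ * _ ^+ 2]mulrC mulrA.
rewrite /phi.
(* Rows and columns of the weights sum to 1 by Parseval, so the single sums of [ln (mu j)] and
   [ln (lam k)] become double sums with the same weights. *)
transitivity (\sum_j \sum_k ((w j)^T *m v k) 0 0 ^+ 2 * (mu j / lam k)
  - (\sum_j \sum_k ((w j)^T *m v k) 0 0 ^+ 2 * ln (mu j)
  - \sum_j \sum_k ((w j)^T *m v k) 0 0 ^+ 2 * ln (lam k))).
  congr (_ - _); congr (_ + _).
  - apply: eq_bigr => j _; rewrite -mulr_suml.
    under eq_bigr do rewrite dotC.
    by rewrite sum_sqr_dot // hw eqxx mul1r.
  - rewrite exchange_big -sumrN; apply: eq_bigr => k _.
    by rewrite -mulr_suml sum_sqr_dot // hv eqxx mul1r lnV ?posrE.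
rewrite -!sumrB; apply: eq_bigr => j _; rewrite -!sumrB; apply: eq_bigr => k _.
by rewrite ln_div ?posrE // -!mulrBr.
Qed.

(** Compressed to the eigenvectors with [mu i != beta], [X - beta I] is diagonal and invertible. It
    factors as [B *m C] through dimension [m], so there are at most [m] such eigenvectors. [S]
    consists of exactly [n - m] of the others. *)
Lemma scalar_plus_rank_ones_eigenpairs m X mu w :
    scalar_plus_rank_ones m X -> orthonormal_cols w -> eigenpairs X mu w ->
  exists (beta : R) (S : {set 'I_n}),
    #|S| = (n - m)%N /\ forall i, i \in S -> mu i = beta.
Proof.
move=> [beta [a [u Xdef]]] hw Xw; exists beta.
pose T := [set i | mu i != beta].
suff Tm : (#|T| <= m)%N.
  have pT : (n - m <= #|~: T|)%N.
    by have := cardsC T; rewrite card_ord => nT; rewrite leq_subLR -[X in (X <= _)%N]nT leq_add2r.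
  exists [set i in take (n - m) (enum (~: T))]; split.
    rewrite cardsE (card_uniqP _) ?take_uniq ?enum_uniq //.
    by rewrite size_takel // -cardE.
  move=> i; rewrite inE => /mem_take; rewrite mem_enum !inE negbK.
  by move/eqP.
pose B := \matrix_(i < #|T|, l < m) ((w (enum_val i))^T *m u l) 0 0.
pose C := \matrix_(l < m, j < #|T|) (a l * ((u l)^T *m w (enum_val j)) 0 0).
have BC : B *m C = diag_mx (\row_(i < #|T|) (mu (enum_val i) - beta)).
  apply/matrixP => i j; rewrite !mxE.
  transitivity (((w (enum_val i))^T *m (X - beta%:M) *m w (enum_val j)) 0 0).
    rewrite Xdef addrC addKr mulmx_sumr mulmx_suml summxE; apply: eq_bigr => l _.
    rewrite -scalemxAr -scalemxAl !mulmxA -(mulmxA (_ *m _)).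
    rewrite [RHS]mxE [in RHS]mxE big_ord1 [X in X * _]mxE [X in _ * X]mxE.
    by rewrite mulrCA.
  rewrite mulmxBr mulmxBl -mulmxA Xw mul_mx_scalar -scalemxAl -scalemxAr -scalerBl mxE hw.
  by rewrite (inj_eq enum_val_inj) mulrC; case: eqVneq => [->|_]; rewrite ?mul1r ?mul0r.
have BCu : B *m C \in unitmx.
  rewrite BC unitmxE det_diag unitfE prodf_seq_neq0; apply/allP => i _ /=.
  by rewrite mxE subr_eq0; have := enum_valP i; rewrite inE.
by rewrite -[X in (X <= _)%N](mxrank_unit BCu) mulmx_max_rank.
Qed.

(** This is the spectral decomposition of [X - beta I], in which the terms from [S] vanish. *)
Lemma eigenpairs_scalar_plus_rank_ones X mu v (beta : R) (S : {set 'I_n}) :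
    orthonormal_cols v -> eigenpairs X mu v -> (forall i, i \in S -> mu i = beta) ->
  scalar_plus_rank_ones #|~: S| X.
Proof.
move=> hv Xv muS.
exists beta, (fun i => mu (enum_val i) - beta), (fun i => v (enum_val i)).
apply: (eigenpairs_unique hv Xv) => k.
rewrite -(big_enum_val (fun j => (mu j - beta) *: (v j *m (v j)^T))).
rewrite mulmxDl mul_scalar_mx mulmx_suml.
have dot j : (mu j - beta) *: (v j *m (v j)^T) *m v k = ((mu j - beta) * (j == k)%:R) *: v j.
  by rewrite -scalemxAl -mulmxA [_^T *m _]mx11_scalar hv mul_mx_scalar scalerA.
under eq_bigr do rewrite dot.
have [kS|kS] := boolP (k \in S).
  rewrite big1 ?addr0 ?muS // => j; rewrite inE => jS.
  by case: eqVneq jS => [->|_ _]; rewrite ?kS // mulr0 scale0r.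
rewrite (bigD1 k) ?inE //= eqxx mulr1 big1 ?addr0 => [|j /andP[_ /negPf ->]].
  by rewrite -scalerDl addrC subrK.
by rewrite mulr0 scale0r.
Qed.

End Eigenbasis.

(** * Windows *)

Lemma sum_in_window (R : realType) (m n : nat) (l : 'I_m.+1) (x : R) : (m < n)%N ->
  \sum_(i < n | in_window l i) x = (n - m)%:R * x.
Proof.
move=> mn; rewrite sumr_const mulr_natl; congr (_ *+ _).
(* As [l <= m], the window is not cut off at the right end. *)
have ln : (l + (n - m) <= n)%N by have := ltn_ord l; lia.
rewrite -sum1_card -(big_mkord (fun i => l <= i < l + (n - m))%N (fun=> 1%N)).
rewrite (eq_bigl (fun i => (true && (i < l + (n - m))) && (l <= i))%N);
  last by move=> i; rewrite andbC.
by rewrite -big_nat_widenl // -big_nat_widen // sum_nat_const_nat muln1 addKn.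
Qed.

Lemma sum1_compl (R : realType) (m n : nat) (S : {set 'I_n}) : (m < n)%N ->
  #|S| = (n - m)%N -> \sum_(j | j \notin S) 1 = m%:R :> R.
Proof.
move=> mn cS; rewrite sumr_const; congr _%:R; have := cardsC S; rewrite card_ord cS.
have <- : #|~: S| = #|[predC S]| by apply: eq_card => i; rewrite !inE.
by move: mn; lia.
Qed.

Section Windows.
Variables (R : realType) (m n : nat) (lam : 'I_n -> R).
Hypotheses (mn : (m < n)%N) (lam0 : forall i, 0 < lam i).
Hypothesis lam_mono : forall i j : 'I_n, (i <= j)%N -> lam i <= lam j.
Implicit Types (l : 'I_m.+1) (S : {set 'I_n}).

Lemma nm_gt0 : 0 < (n - m)%:R :> R. Proof. by rewrite ltr0n subn_gt0. Qed.

Lemma window_hmean_gt0 l : 0 < window_hmean lam l.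
Proof.
rewrite invr_gt0 divr_gt0 ?nm_gt0 //.
(* The window sum of a positive constant is nonzero, so the window is not empty. *)
have h : \sum_(i < n | in_window l i) (lam (Ordinal (leq_ltn_trans (leq0n m) mn)))^-1 != 0.
  by rewrite sum_in_window // mulf_neq0 ?invr_neq0 ?gt_eqF ?nm_gt0.
rewrite lt_neqAle sumr_ge0 ?andbT => [|i _]; last by rewrite invr_ge0 ltW.
rewrite eq_sym psumr_eq0 => [|i _]; last by rewrite invr_ge0 ltW.
apply: contra h => /allP s0; rewrite big1 // => i iw.
by have := s0 i (mem_index_enum _); rewrite iw /= gt_eqF // invr_gt0.
Qed.

(** With [h] the harmonic mean, the inverses of [lam i] over the window sum to [(n - m) / h], and
    replacing [h] by [beta] adds [(beta - h) / lam i - ln (beta / h)] to each term. By [phi_ge1],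
    [h] is the only best [beta]. *)
Lemma sum_phi_window l (beta : R) : 0 < beta ->
  \sum_(i < n | in_window l i) phi (beta / lam i) =
  window_cost lam l + (n - m)%:R * (phi (beta / window_hmean lam l) - 1).
Proof.
move=> b0; have h0 := window_hmean_gt0 l; set h := window_hmean lam l in h0 *.
have sum_inv : \sum_(i < n | in_window l i) (lam i)^-1 = (n - m)%:R / h.
  by rewrite /h invrK mulrC divfK // gt_eqF // nm_gt0.
apply/eqP; rewrite addrC -subr_eq /window_cost -/h -sumrB; apply/eqP.
transitivity (\sum_(i < n | in_window l i) ((beta - h) * (lam i)^-1 - ln (beta / h))).
  by apply: eq_bigr => i _; rewrite /phi !ln_div ?posrE //; ring.
rewrite sumrB -mulr_sumr sum_inv sum_in_window // /phi.
by field; rewrite gt_eqF.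
Qed.

Lemma min_sum_set_window S (beta : R) : 0 < beta -> #|S| = (n - m)%N ->
    min_sum_set (fun i => phi (beta / lam i)) S ->
  exists (s : {perm 'I_n}) l, [/\ tie_perm lam s,
    forall i, (s i \in S) = in_window l i
    & \sum_(i in S) phi (beta / lam i) = \sum_(i < n | in_window l i) phi (beta / lam i)].
Proof.
move=> b0 cS Smin.
have nogap a b k : a \in S -> b \in S -> k \notin S -> ~~ (lam a < lam k < lam b).
  (* Division of [beta] reverses the order. An outside value strictly between two values of [S]
     would give a smaller [phi] than one of them, against the exchange argument. *)
  move=> aS bS kS; apply/negP => /andP[ak kb].
  have [||||] := @phi_between R (beta / lam b) (beta / lam k) (beta / lam a).
  - by rewrite divr_gt0.
  - by rewrite ltr_pM2l // ltf_pV2 ?posrE.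
  - by rewrite ltr_pM2l // ltf_pV2 ?posrE.
  - by rewrite ltNge (min_sum_set_threshold Smin).
  - by rewrite ltNge (min_sum_set_threshold Smin).
have S0 : (0 < #|S|)%N by rewrite cS subn_gt0.
have [s [l [s_tie ln sS]]] := no_gap_window lam_mono S0 nogap.
have lm : (l < m.+1)%N by move: ln; rewrite cS; lia.
have sW i : (s i \in S) = in_window (Ordinal lm) i by rewrite sS cS.
exists s, (Ordinal lm); split=> //.
rewrite (reindex_inj (@perm_inj _ s)); apply: eq_big => // i _.
by rewrite s_tie.
Qed.

Lemma window_cost_le_weights (beta : R) (d : 'I_n -> R) : 0 < beta ->
    (forall i, 0 <= d i <= 1) -> \sum_i d i = (n - m)%:R ->
  exists l, window_cost lam l <= \sum_i d i * phi (beta / lam i).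
Proof.
move=> b0 d01 sumd.
have [|S [cS Smin]] := @exists_min_sum_set R 'I_n (fun i => phi (beta / lam i)) (n - m).
  by rewrite card_ord leq_subr.
have [s [l [_ _ sumS]]] := min_sum_set_window b0 cS Smin.
exists l; apply: (@le_trans _ _ (\sum_(i in S) phi (beta / lam i))).
  rewrite sumS sum_phi_window // lerDl mulr_ge0 ?ler0n // subr_ge0.
  by rewrite phi_ge1 ?divr_gt0 ?window_hmean_gt0.
by apply: min_sum_set_weights; rewrite ?cS ?subn_gt0.
Qed.

(** Equality case of [window_cost_le_weights]. Applied to the indicator of any [S'] of the same
    size, that lemma shows that [S] has minimal sum, so [S] is a window up to ties. Its sum then
    equals the window cost, which forces [beta] to be the harmonic mean and [l] to be a
    minimizer. *)
Lemma optimal_set_window S (beta : R) : 0 < beta -> #|S| = (n - m)%N ->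
    (forall l, \sum_(i in S) phi (beta / lam i) <= window_cost lam l) ->
  exists (s : {perm 'I_n}) l, [/\ tie_perm lam s, window_minimizer lam l,
    beta = window_hmean lam l, forall i, (s i \in S) = in_window l i
    & \sum_(i in S) phi (beta / lam i) = window_cost lam l].
Proof.
move=> b0 cS Sle.
have Smin : min_sum_set (fun i => phi (beta / lam i)) S.
  move=> S' cS'; have [||l Sl] := @window_cost_le_weights beta (fun i => (i \in S')%:R) b0.
  - by move=> i; case: (i \in S'); rewrite /= ?lexx ?ler01.
  - by rewrite sum_indicator cS' cS.
  apply: le_trans (Sle l) (le_trans Sl _); rewrite [leRHS]big_mkcond.
  by apply: ler_sum => i _; case: ifP; rewrite ?mul1r ?mul0r.
have [s [l [s_tie sW sumS]]] := min_sum_set_window b0 cS Smin.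
have bh : 0 < beta / window_hmean lam l by rewrite divr_gt0 ?window_hmean_gt0.
have cost : window_cost lam l <= \sum_(i in S) phi (beta / lam i)
    ?= iff (beta == window_hmean lam l).
  rewrite sumS sum_phi_window //.
  have -> : (beta == window_hmean lam l) = (beta / window_hmean lam l == 1).
    by rewrite -[RHS](inj_eq (mulIf (lt0r_neq0 (window_hmean_gt0 l)))) divfK ?mul1r //
      gt_eqF // window_hmean_gt0.
  split; first by rewrite lerDl pmulr_rge0 ?nm_gt0 // subr_ge0 phi_ge1.
  rewrite -[eqbLHS]addr0 (inj_eq (addrI _)) eq_sym mulf_eq0 gt_eqF ?nm_gt0 //=.
  by rewrite subr_eq0 eq_sym (phi_ge1 bh).2.
have sumE : \sum_(i in S) phi (beta / lam i) = window_cost lam l.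
  by apply: le_anti; rewrite Sle cost.1.
exists s, l; split=> //; last by apply/eqP; rewrite -cost.2 sumE.
by move=> l'; rewrite -sumE.
Qed.

End Windows.

(** * Lower bound, attainment and the equality case *)

Section Optimum.
Variables (R : realType) (m n : nat) (A : 'M[R]_n).
Variables (lam : 'I_n -> R) (v : 'I_n -> 'cV[R]_n).
Hypotheses (mn : (m < n)%N) (lam0 : forall i, 0 < lam i).
Hypotheses (hv : orthonormal_cols v) (Av : eigenpairs A lam v).

Lemma objective_common_eigenbasis X mu : eigenpairs X mu v -> (forall i, 0 < mu i) ->
  objective A X = \sum_i phi (mu i / lam i).
Proof.
move=> Xv mu0; rewrite (objective_eigenpairs hv Av lam0 hv Xv mu0).
apply: eq_bigr => j _; rewrite (bigD1 j) //= hv eqxx expr1n mul1r big1 ?addr0 //.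
by move=> k kj; rewrite hv eq_sym (negPf kj) expr0n mul0r.
Qed.

(* The weight [d k] is the squared length of the projection of [v k] on the
   span of the eigenvectors of [Y] in [S]. *)
Lemma feasible_lower_bound Y :
    (forall i j : 'I_n, (i <= j)%N -> lam i <= lam j) -> feasible m Y ->
  exists l : 'I_m.+1, m%:R + window_cost lam l <= objective A Y.
Proof.
move=> lam_mono [Yrank Ypos].
have [mu [w [hw Yw]]] := symmetric_spectral Ypos.1.
have mu0 := (posdefmx_eigenpairs hw Yw).1 Ypos.
have [beta [S [cS muS]]] := scalar_plus_rank_ones_eigenpairs Yrank hw Yw.
have [j0 j0S] : exists j, j \in S by apply/set0Pn; rewrite -card_gt0 cS subn_gt0.
have b0 : 0 < beta by rewrite -(muS j0).
pose D j k := ((w j)^T *m v k) 0 0 ^+ 2.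
have D0 j k : 0 <= D j k by rewrite sqr_ge0.
have Dcol k : \sum_j D j k = 1 by rewrite sum_sqr_dot // hv eqxx.
have Drow j : \sum_k D j k = 1.
  rewrite /D; under eq_bigr do rewrite dotC.
  by rewrite sum_sqr_dot // hw eqxx.
pose d k := \sum_(j in S) D j k.
have [||l dl] := @window_cost_le_weights R m n lam mn lam0 lam_mono beta d b0.
- move=> k; rewrite sumr_ge0 //= -(Dcol k) [leRHS](bigID (mem S)) lerDl.
  exact: sumr_ge0.
- by rewrite exchange_big; under eq_bigr do rewrite Drow; rewrite sumr_const cS.
exists l; rewrite (objective_eigenpairs hv Av lam0 hw Yw mu0) (bigID (mem S)) addrC.
apply: lerD.
  rewrite /=; apply: (le_trans dl).
  rewrite (eq_bigr (fun k => \sum_(j in S) D j k * phi (beta / lam k))); last first.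
    by move=> k _; rewrite mulr_suml.
  by rewrite exchange_big; apply: ler_sum => j jS; rewrite muS.
(* Each of the [m] rows outside [S] has total weight 1 and [phi >= 1], so these rows contribute at
   least [m]. *)
rewrite -(sum1_compl R mn cS).
apply: ler_sum => j _; rewrite -(Drow j); apply: ler_sum => k _.
by rewrite ler_peMr // phi_ge1 ?divr_gt0.
Qed.

Lemma card_in_window (l : 'I_m.+1) : #|[set i : 'I_n | in_window l i]| = (n - m)%N.
Proof.
apply/eqP; rewrite -(eqr_nat R) -[eqbRHS]mulr1 -(sum_in_window l 1 mn) sumr_const.
by rewrite cardsE.
Qed.

(** The image of the window under [s] misses [m] indices, which supply the rank-one terms. At those
    indices [mu] agrees with [lam], so each contributes [phi 1 = 1] to the objective. *)
Lemma window_feasible X mu (s : {perm 'I_n}) (l : 'I_m.+1) :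
    eigenpairs X mu v -> tie_perm lam s ->
    (forall i, mu (s i) = window_eigenvalue lam l i) ->
  feasible m X /\ objective A X = m%:R + window_cost lam l.
Proof.
move=> Xv s_tie mus.
have mu0 i : 0 < mu i.
  rewrite -(permKV s i) mus /window_eigenvalue.
  by case: ifP => // _; apply: window_hmean_gt0.
split.
  split; last exact/(posdefmx_eigenpairs hv Xv).
  pose S := s @: [set i | in_window l i].
  have cS : #|~: S| = m.
    have := cardsC S; rewrite card_ord card_imset; last exact: perm_inj.
    by rewrite card_in_window; move: mn; lia.
  rewrite -cS; apply: (eigenpairs_scalar_plus_rank_ones (beta := window_hmean lam l) hv Xv).
  by move=> _ /imsetP[i + ->]; rewrite inE mus /window_eigenvalue => ->.
rewrite (objective_common_eigenbasis Xv mu0) (reindex_inj (@perm_inj _ s)) /=.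
under eq_bigr do rewrite mus s_tie.
rewrite (bigID (in_window l)) [RHS]addrC /=; congr (_ + _).
  by apply: eq_bigr => i il; rewrite /window_eigenvalue il.
transitivity (\sum_(i < n | ~~ in_window l i) (1 : R)).
  apply: eq_bigr => i il; rewrite /window_eigenvalue (negPf il).
  by rewrite divff ?gt_eqF // /phi ln1 subr0.
have : \sum_(i < n) (1 : R) = n%:R by rewrite sumr_const card_ord.
rewrite (bigID (in_window l)) /= sum_in_window // mulr1 -[in RHS](subnK (ltnW mn)) natrD.
exact: addrI.
Qed.

End Optimum.

(* When A has a multiple eigenvalue, the numbering of the eigenvectors inside
   an eigenspace is arbitrary, and for one fixed numbering an optimal X may
   take the common value lambda on a non-contiguous set of indices. The
   permutation s renumbers eigenvectors with equal eigenvalues. For distinct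
   eigenvalues s is the identity. *)
Theorem theorem5 (R : realType) (m n : nat) (hmn : (m < n)%N)
    (A : 'M[R]_n) (hA : posdefmx A)
    (lam : 'I_n -> R) (v : 'I_n -> 'cV[R]_n)
    (hlam : forall i j : 'I_n, (i <= j)%N -> lam i <= lam j)
    (hv : orthonormal_cols v) (hAv : eigenpairs A lam v) :
  forall X : 'M[R]_n,
    (optimal m A X /\ exists mu : 'I_n -> R, eigenpairs X mu v)
    <->
    (exists mu : 'I_n -> R, eigenpairs X mu v /\
      exists (s : {perm 'I_n}) (l : 'I_m.+1),
        [/\ tie_perm lam s, window_minimizer lam l
          & forall i : 'I_n, mu (s i) = window_eigenvalue lam l i]).
Proof.
have lam0 := (posdefmx_eigenpairs hv hAv).1 hA.
move=> X; split.
- move=> [[[Xrank Xpos] Xopt] [mu Xv]]; exists mu; split=> //.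
  have mu0 := (posdefmx_eigenpairs hv Xv).1 Xpos.
  have [beta [S [cS muS]]] := scalar_plus_rank_ones_eigenpairs Xrank hv Xv.
  have [j0 j0S] : exists j, j \in S by apply/set0Pn; rewrite -card_gt0 cS subn_gt0.
  have b0 : 0 < beta by rewrite -(muS j0).
  have ge1 i : 1 <= phi (mu i / lam i) ?= iff (mu i / lam i == 1).
    by apply: phi_ge1; rewrite divr_gt0.
  have obj : objective A X =
      \sum_(i in S) phi (beta / lam i) + \sum_(i | i \notin S) phi (mu i / lam i).
    rewrite (objective_common_eigenbasis lam0 hv hAv Xv mu0) (bigID (mem S)) /=.
    by congr (_ + _); apply: eq_bigr => i iS; rewrite muS.
  have obj_le (l : 'I_m.+1) : objective A X <= m%:R + window_cost lam l.
    (* The competitor has eigenbasis [v] and the eigenvalues of window [l], with the identity as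
       permutation. *)
    have Yv : eigenpairs (cols_mx v *m diag_mx (\row_k window_eigenvalue lam l k)
        *m (cols_mx v)^T) (window_eigenvalue lam l) v by apply/eigenpairs_decomp.
    have [||Yf <-] := window_feasible hmn lam0 hv hAv (s := 1%g) (l := l) Yv.
    - by move=> i; rewrite perm1.
    - by move=> i; rewrite perm1.
    exact: Xopt.
  have [|s [l [s_tie lmin bh sS sumS]]] := optimal_set_window hmn lam0 hlam b0 cS.
    (* The terms outside [S] sum to at least [m], so those in [S] sum to at most the window cost. *)
    move=> l; have := obj_le l; rewrite obj addrC; apply: contraTT; rewrite -!ltNge => lt.
    by apply: ler_ltD lt; rewrite -(sum1_compl R hmn cS); apply: ler_sum => i _; apply: (ge1 i).1.
  exists s, l; split=> // i; rewrite /window_eigenvalue -sS.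
  case: ifPn => siS; first by rewrite muS.
  (* Now [S] accounts for exactly the window cost, so the [m] terms outside it sum to at most [m].
     Each is at least 1, hence equal to 1, and [mu] agrees with [lam] there. *)
  have := obj_le l; rewrite obj sumS addrC lerD2r -(sum1_compl R hmn cS) => le1.
  have sum1 : \sum_(j | j \notin S) phi (mu j / lam j) - \sum_(j | j \notin S) (1 : R) == 0.
    rewrite subr_eq0 eq_le le1 /=; apply: ler_sum => j _; apply: (ge1 j).1.
  move: sum1; rewrite -sumrB psumr_eq0 => [/allP all1|j _]; last by rewrite subr_ge0 ge1.
  have := all1 (s i) (mem_index_enum _); rewrite siS /= subr_eq0 eq_sym (ge1 _).2.
  by move/eqP/(congr1 ( *%R^~ (lam (s i)))); rewrite divfK ?gt_eqF // mul1r s_tie.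
- move=> [mu [Xv [s [l [s_tie lmin mus]]]]]; split; last by exists mu.
  have [Xf Xobj] := window_feasible hmn lam0 hv hAv Xv s_tie mus.
  split=> // Y /(feasible_lower_bound hmn lam0 hv hAv hlam) [l' Yl'].
  by rewrite Xobj; apply: le_trans Yl'; rewrite lerD2l; apply: lmin.
Qed.
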